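(* Let $q$ be a prime power, let $n\ge 1$ be an integer, and assume that $(\mathbb{Z}/q\mathbb{Z})^n$ satisfies property $D$. Then $$\mathfrak{s}\left((\mathbb{Z}/q\mathbb{Z})^n\right)\leq (q-1)\,4^n+1 .$$
   Context: For a finite abelian group $G$, $\exp(G)$ denotes its exponent (the maximal order of an element of $G$). The Erd\H{o}s-Ginzburg-Ziv constant $\mathfrak{s}(G)$ is the smallest $m\in\mathbb{N}$ such that any sequence of $m$ elements of $G$ (repetitions allowed) contains a subsequence of length $\exp(G)$ whose sum is $0$. A finite abelian group $G$ satisfies property $D$ if every sequence $S$ of elements of $G$ of length $\mathfrak{s}(G)-1$ that does not contain a subsequence of length $\exp(G)$ summing to $0$, when viewed as a multiset, has the form $S=\bigcup_{i=1}^{\exp(G)-1}T$ (multiset union of $\exp(G)-1$ copies of $T$) for some set $T\subset G$; that is, every element appearing in $S$ appears exactly $\exp(G)-1$ times. *)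

(* Defs.v *)
From mathcomp Require Import all_boot all_algebra all_fingroup all_solvable.

Set Implicit Arguments.
Unset Strict Implicit.
Unset Printing Implicit Defensive.

Import GRing.Theory.

(* [exponent] is defined by the library as the lcm of the orders of the
   elements; here the additive group [G] is viewed through its canonical
   [finGroupType] structure. *)
Definition expo (G : finZmodType) : nat := exponent [set: G].

Lemma expoE (G : finZmodType) : expo G = \max_(x : G) #[x]%g.
Proof.
apply/eqP; rewrite eqn_leq; apply/andP; split.
  have [x _ Ex] := exponent_witness (abelian_nil (FinRing.zmod_abelian [set: G]%G)).
  by rewrite /expo Ex; exact: (leq_bigmax x).
apply/bigmax_leqP => x _.
by apply: dvdn_leq; rewrite ?exponent_gt0 ?dvdn_exponent ?inE.
Qed.

(* Subsequences need not be contiguous, see [subseq]. *)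
Definition has_zero_sum (G : finZmodType) (S : seq G) : bool :=
  [exists T : (expo G).-tuple G,
    subseq T S && ((\sum_(x <- T) x)%R == 0%R)].

Definition egz_bound (G : finZmodType) (m : nat) : bool :=
  [forall S : m.-tuple G, has_zero_sum S].

(* Pigeonhole: some element occurs at least [expo G] times. *)
Lemma egz_bound_exists (G : finZmodType) : exists m, egz_bound G m.
Proof.
exists (#|G| * expo G); apply/forallP => S.
have [x le_x] : exists x : G, expo G <= count_mem x S.
  apply/existsP; apply/contraT; rewrite negb_exists => /forallP lt_e.
  have e_gt0 : 0 < expo G by rewrite exponent_gt0.
  have G_gt0 : 0 < #|G| by apply/card_gt0P; exists 0%R.
  have sumS : \sum_(x : G) count_mem x S = #|G| * expo G.
    rewrite -[RHS](size_tuple S) -sum1_size.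
    have countE x : count_mem x S = \sum_(y <- S) (y == x).
      by rewrite -sum1_count big_mkcond /=; apply: eq_bigr => y _; case: eqP.
    rewrite (eq_bigr _ (fun x _ => countE x)).
    rewrite exchange_big; apply: eq_bigr => y _ /=.
    rewrite (bigD1 y) //= eqxx big1 ?addn0 // => x.
    by rewrite eq_sym => /negbTE->.
  have : \sum_(x : G) count_mem x S <= \sum_(x : G) (expo G).-1.
    by apply: leq_sum => x _; rewrite -ltnS prednK // ltnNge lt_e.
  by rewrite sumS sum_nat_const leq_pmul2l // leqNgt prednK ?leqnn.
apply/existsP; exists [tuple of nseq (expo G) x]; apply/andP; split.
  apply: subseq_trans (filter_subseq (pred1 x) S).
  rewrite (all_pred1P _ _ (filter_all _ _)) size_filter /=.
  by rewrite -(subnKC le_x) nseqD prefix_subseq.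
rewrite big_nseq; apply/eqP.
have -> : iter (expo G) (+%R x) 0%R = (x *+ expo G)%R.
  by elim: (expo G) => [|e IHe]; rewrite ?mulr0n //= IHe mulrS.
by rewrite -FinRing.zmodXgE -FinRing.zmod1gE expg_exponent ?inE.
Qed.

(* The Erdos-Ginzburg-Ziv constant. *)
Definition egz (G : finZmodType) : nat := ex_minn (egz_bound_exists G).

Lemma egz_gt0 (G : finZmodType) : 0 < egz G.
Proof.
rewrite /egz; case: ex_minnP => -[|//] /forallP/(_ [tuple])/existsP[T].
rewrite subseq0 => /andP[/eqP T0 _] _; move: (size_tuple T).
by rewrite T0 => /esym/eqP; rewrite -leqn0 leqNgt exponent_gt0.
Qed.

(* The truncated predecessors are harmless, see [exponent_gt0] and [egz_gt0]. *)
Definition propertyD (G : finZmodType) : Prop :=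
  forall S : seq G, size S = (egz G).-1 -> ~~ has_zero_sum S ->
  exists T : {set G}, perm_eq S (flatten (nseq (expo G).-1 (enum T))).

(* Main.v *)
(** Property D yields a set [T] of size [(egz - 1) / (q - 1)] in which a zero-sum
    sequence of length [q = p ^ k] must be constant.  If [T] had more than
    ['C(2n, n)] points, some nonzero [h : T -> 'F_p] would annihilate all products
    [\prod_c 'C(x_c, b_c)] with [\sum_c b_c <= n].  Fix [x0] with [h x0 != 0] and
    sum [h y_1 * ... * h y_(q-1)] over the [y] in [T ^ (q - 1)] such that
    [x0 + y_1 + ... + y_(q-1) = 0].  Only [y_1 = ... = y_(q-1) = x0] contributes, so
    the sum is nonzero.  But modulo [p] the condition [q %| s] is detected by
    ['C(s + q - 1, q - 1)], and by Vandermonde's identity the sum expands into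
    products in which the degrees in [y_1, ..., y_(q-1)] add up to at most
    [n (q - 1)], so that some [y_i] has degree at most [n]; hence it vanishes. *)

Require Import Defs.
From mathcomp Require Import all_boot all_algebra all_fingroup all_solvable.

Set Implicit Arguments.
Unset Strict Implicit.
Unset Printing Implicit Defensive.

Import GRing.Theory.

(** If [p] does not divide it, it is coprime to [p ^ k], and [i * 'C(p ^ k, i) = p ^ k * 'C(p ^ k -
    1, i - 1)] makes [p ^ k] divide [i < p ^ k]. *)
Lemma dvdn_bin_primeX (p k i : nat) :
  prime p -> 0 < i < p ^ k -> p %| 'C(p ^ k, i).
Proof.
case: i => // i p_pr /andP[_ lt_i]; apply: contraLR lt_i.
rewrite -prime_coprime // -leqNgt => /(coprimeXl k) co_q.
apply: dvdn_leq => //; rewrite -(Gauss_dvdl _ co_q) -mul_bin_diag.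
exact: dvdn_mulr.
Qed.

(** When one period [p ^ k] is split off by Vandermonde, every term but the first has a factor
    ['C(p ^ k, i)] with [0 < i < p ^ k]. *)
Lemma modn_bin_add_primeX (p k j s t : nat) :
  prime p -> j < p ^ k -> 'C(s + t * p ^ k, j) = 'C(s, j) %[mod p].
Proof.
move=> p_pr lt_j; elim: t => [|t IHt]; first by rewrite addn0.
rewrite mulSn addnCA -binomial.Vandermonde big_ord_recl bin0 mul1n subn0 -IHt.
rewrite -modnDmr; suff /eqP-> : p %| \sum_(i < j) 'C(p ^ k, lift ord0 i) *
    'C(s + t * p ^ k, j - lift ord0 i) by rewrite addn0.
apply: dvdn_sum => i _; apply/dvdn_mulr/dvdn_bin_primeX => //.
by rewrite lift0 /=; apply: leq_trans lt_j; rewrite ltnS.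
Qed.

(** By periodicity only [s %% q] matters: residue [0] gives ['C(q - 1, q - 1) = 1], and residue
    [r + 1] gives ['C(r, q - 1) = 0] since [r < q - 1]. *)
Lemma dvdn_bin_pred_primeX (p k s : nat) :
  prime p -> (p %| 'C(s + (p ^ k).-1, (p ^ k).-1)) = ~~ (p ^ k %| s).
Proof.
move=> p_pr; set q := p ^ k.
have q_gt0 : 0 < q by rewrite expn_gt0 prime_gt0.
have lt_q : q.-1 < q by rewrite prednK.
rewrite {1}(divn_eq s q) /(dvdn q s); case: (s %% q) (ltn_pmod s q_gt0) => [|r].
  rewrite addn0 addnC /dvdn modn_bin_add_primeX // binn modn_small ?prime_gt1 //.
rewrite -addnA addSnnS prednK // addnCA -mulSnr /dvdn => lt_r.
by rewrite modn_bin_add_primeX // bin_small ?mod0n // -ltnS prednK.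
Qed.

Local Open Scope ring_scope.

Lemma exists_linear_relation (F : fieldType) (I J : finType) (f : I -> J -> F) :
  (#|J| < #|I|)%N ->
  exists2 h : I -> F, exists i, h i != 0 & forall j, \sum_i h i * f i j = 0.
Proof.
move=> lt_JI.
pose A : 'M[F]_(#|I|, #|J|) := \matrix_(i, j) f (enum_val i) (enum_val j).
have /rowV0Pn[v /sub_kermxP vA v_neq0] : kermx A != 0.
  rewrite kermx_eq0 -row_leq_rank -ltnNge.
  exact: leq_ltn_trans (rank_leq_col A) lt_JI.
exists (fun i => v 0 (enum_rank i)) => [|j].
  have /rV0Pn[i vi] := v_neq0.
  by exists (enum_val i); rewrite enum_valK.
move/rowP/(_ (enum_rank j)): vA; rewrite !mxE => vA.
rewrite -[RHS]vA (reindex_onto enum_val enum_rank) => [|i _]; last exact: enum_rankK.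
apply: eq_big => i; rewrite ?enum_valK ?eqxx // => _.
by rewrite mxE !enum_rankK.
Qed.

Section BinomialConvolution.

Variables (F : comNzRingType) (I : finType) (n : nat).
Variables (pt : I -> 'I_n -> nat) (w : I -> F).
Implicit Types a u y : 'I_n -> nat.

(* [\sum_(y in I ^ m) \prod_i w (y_i) * \prod_c 'C(u_c + \sum_i pt (y_i) c, a_c)] *)
Fixpoint bin_conv (m : nat) a u : F :=
  if m is m'.+1 then \sum_i w i * bin_conv m' a (fun c => u c + pt i c)%N
  else \prod_c ('C(u c, a c))%:R.

Lemma eq_bin_conv m a u u' : u =1 u' -> bin_conv m a u = bin_conv m a u'.
Proof.
elim: m u u' => [|m IHm] u u' eq_u /=; apply: eq_bigr => c _; first by rewrite eq_u.
by congr (_ * _); apply: IHm => d; rewrite eq_u.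
Qed.

(** Isolates the dependence on one point [y], whose weight can then be summed separately. The bound
    [M] lets [b] range over a finite type. *)
Lemma bin_conv_Vandermonde (M : nat) m a u y : (forall c, (a c <= M)%N) ->
  bin_conv m a (fun c => u c + y c)%N =
  \sum_(b in family (fun c => [pred j : 'I_M.+1 | (j <= a c)%N]))
     (\prod_c ('C(y c, b c))%:R) * bin_conv m (fun c => a c - b c)%N u.
Proof.
move=> le_aM; elim: m u => [|m IHm] u /=.
  under [RHS]eq_bigr => b _ do rewrite -big_split.
  rewrite -(bigA_distr_big_dep _ (fun c (j : 'I_M.+1) => ('C(y c, j))%:R * ('C(u c, a c - j))%:R)).
  apply: eq_bigr => c _; rewrite addnC -binomial.Vandermonde natr_sum.
  rewrite (big_ord_widen M.+1 (fun j => ('C(y c, j) * 'C(u c, a c - j))%:R)) ?ltnS //.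
  by apply: eq_big => // j _; rewrite natrM.
under [RHS]eq_bigr => b _ do rewrite mulr_sumr.
rewrite exchange_big; apply: eq_bigr => i _ /=.
rewrite (@eq_bin_conv m a _ (fun c => (u c + pt i c) + y c)%N); last first.
  by move=> c; rewrite addnAC.
by rewrite IHm mulr_sumr; apply: eq_bigr => b _; rewrite mulrCA.
Qed.

(** Degree pigeonhole, one point at a time: a term where the split-off point has degree at most [d]
    is killed by [w]; otherwise the remaining degree drops by at least [d + 1] and induction
    applies. *)
Lemma bin_conv_eq0 (d m : nat) a u :
  (forall b : 'I_n -> nat, (\sum_c b c <= d)%N ->
     \sum_i w i * \prod_c ('C(pt i c, b c))%:R = 0) ->
  (\sum_c a c < m * d.+1)%N -> bin_conv m a u = 0.
Proof.
move=> w_ann; elim: m a u => [//|m IHm] a u lt_a /=.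
pose M := (\sum_c a c)%N.
have le_aM c : (a c <= M)%N by rewrite /M (bigD1 c) // leq_addr.
under eq_bigr => i _ do rewrite (bin_conv_Vandermonde _ _ _ le_aM) mulr_sumr.
rewrite exchange_big big1 // => b /familyP le_ba /=.
under eq_bigr => i _ do rewrite mulrA.
rewrite -mulr_suml; have [le_bd|lt_db] := leqP (\sum_c b c)%N d.
  by rewrite w_ann ?mul0r.
rewrite IHm ?mulr0 // sumnB => [|c _]; last exact: le_ba.
rewrite ltn_subLR; last by apply: leq_sum => c _; exact: le_ba.
by apply: leq_trans lt_a _; rewrite mulSn leq_add2r.
Qed.

End BinomialConvolution.

(** There are ['C(n + d, n)] exponent vectors [b] of degree at most [d], hence fewer linear
    conditions than unknowns [h i]. *)
Lemma exists_bin_annihilator (F : fieldType) (I : finType) (n d : nat)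
    (pt : I -> 'I_n -> nat) : ('C(n + d, n) < #|I|)%N ->
  exists2 h : I -> F, exists i, h i != 0 &
    forall b : 'I_n -> nat, (\sum_c b c <= d)%N ->
      \sum_i h i * \prod_c ('C(pt i c, b c))%:R = 0.
Proof.
rewrite -card_partial_ord_partitions => lt_C.
pose B := [set t : n.-tuple 'I_d.+1 | \sum_(i <- t) i <= d]%N.
have [|h h_neq0 hB] := @exists_linear_relation F I {t | t \in B}
  (fun i t => \prod_c ('C(pt i c, tnth (val t) c))%:R).
  by rewrite card_sig.
exists h => // b le_b.
have lt_b c : (b c < d.+1)%N.
  by rewrite ltnS; apply: leq_trans le_b; rewrite (bigD1 c) // leq_addr.
have tB : [tuple Ordinal (lt_b c) | c < n] \in B.
  rewrite inE big_tuple.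
  by under eq_bigr => c _ do rewrite tnth_mktuple.
rewrite -[RHS](hB (exist (fun t => t \in B) _ tB)); apply: eq_bigr => i _; congr (_ * _).
by apply: eq_bigr => c _; rewrite tnth_mktuple.
Qed.

Lemma card_rigid_family (p k n : nat) (I : finType) (pt : I -> 'I_n -> nat) :
  prime p -> (0 < k)%N ->
  (forall l : seq I, size l = (p ^ k)%N ->
     (forall c, p ^ k %| \sum_(i <- l) pt i c)%N -> constant l) ->
  (#|I| <= 'C(n + n, n))%N.
Proof.
move=> p_pr k_gt0 rigid; rewrite leqNgt; apply/negP => /exists_bin_annihilator.
case/(_ 'F_p pt) => h [x0 hx0] h_ann.
set q := (p ^ k)%N in rigid *.
have q_gt1 : (1 < q)%N by rewrite -(exp1n k) ltn_exp2r ?prime_gt1.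
have charp := pchar_Fp p_pr.
(* The shift by [q.-1] makes ['C(u l c, q.-1)] nonzero in ['F_p] exactly when [q] divides the [c]-th
   coordinate sum of [l]. *)
pose u l c := (\sum_(i <- l) pt i c + q.-1)%N.
pose a (c : 'I_n) := q.-1.
have dvd_q s : (('C(s + q.-1, q.-1))%:R == 0 :> 'F_p) = ~~ (q %| s)%N.
  by rewrite -(dvdn_pcharf charp) dvdn_bin_pred_primeX.
pose P : 'F_p := \prod_c ('C(u (nseq q x0) c, a c))%:R.
have P_neq0 : P != 0.
  apply/prodf_neq0 => c _; rewrite dvd_q negbK big_nseq iter_addn_0.
  exact: dvdn_mull.
(* Here [l] lists the points already chosen and [m] counts those still free; by rigidity only the
   choice of [x0] throughout survives. *)
have convE m l : (size l + m = q.-1)%N -> bin_conv pt h m a (u (x0 :: l)) =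
    if all (pred1 x0) l then h x0 ^+ m * P else 0.
  elim: m l => [|m IHm] l sz_l /=.
    have szq : size (x0 :: l) = q by rewrite /= -[size l]addn0 sz_l prednK // ltnW.
    case: ifP => [/all_pred1P l_x0|not_const].
      by rewrite mul1r /P -szq /= -l_x0.
    apply/eqP; apply/contraFT: not_const => /prodf_neq0 nz.
    by apply: (rigid (x0 :: l)) => // c; rewrite -[(_ %| _)%N]negbK -dvd_q nz.
  transitivity (\sum_i h i * bin_conv pt h m a (u [:: x0, i & l])).
    apply: eq_bigr => i _; congr (_ * _); apply: eq_bin_conv => c.
    by rewrite /u !big_cons addnAC -(addnA (pt x0 c)) (addnC _ (pt i c)).
  under eq_bigr => i _ do rewrite IHm ?addSnnS //=.
  rewrite (bigD1 x0) //= eqxx /= big1 ?addr0 => [|i /negbTE->]; last by rewrite mulr0.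
  by case: ifP => _; rewrite ?mulr0 // exprS mulrA.
have := convE q.-1 [::] (add0n _).
rewrite (bin_conv_eq0 _ h_ann) => [/esym/eqP|].
  by rewrite mulf_eq0 expf_eq0 (negbTE hx0) andbF (negbTE P_neq0).
(* The total degree [n * (q - 1)] is less than [(q - 1) * (n + 1)]. *)
by rewrite sum_nat_const card_ord mulnC ltn_pmul2l // -ltnS prednK // ltnW.
Qed.

Local Close Scope ring_scope.

(** For [q <= 1] the type ['Z_q] defaults to the integers modulo 2. *)
Lemma natr_Zp_eq0 (q m : nat) : 1 < q -> (m%:R == 0 :> 'Z_q)%R = (q %| m).
Proof. by move=> q_gt1; rewrite -val_eqE /= val_Zp_nat. Qed.

Lemma expo_rV_Zp (q n : nat) : 1 < q -> 0 < n -> expo 'rV['Z_q]_n = q.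
Proof.
move=> q_gt1 n_gt0; apply/eqP; rewrite eqn_dvd; apply/andP; split.
  apply/exponentP => x _; rewrite FinRing.zmodXgE FinRing.zmod1gE.
  apply/rowP => c; rewrite mulmxnE mxE -mulr_natr.
  by have := natr_Zp_eq0 q q_gt1; rewrite dvdnn => /eqP->; rewrite mulr0.
have x1_exp : (const_mx 1 *+ expo 'rV['Z_q]_n = 0 :> 'rV['Z_q]_n)%R.
  by rewrite -FinRing.zmodXgE -FinRing.zmod1gE expg_exponent ?inE.
have /eqP := congr1 (fun x : 'rV['Z_q]_n => x 0%R (Ordinal n_gt0)) x1_exp.
by rewrite mulmxnE !mxE natr_Zp_eq0.
Qed.

(** This is one term in the expansion of [(1 + 1) ^ (n + n)]. *)
Lemma bin_double_le (n : nat) : 'C(n + n, n) <= 4 ^ n.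
Proof.
rewrite -[4]/(2 ^ 2) -expnM mul2n -addnn -[2]/(1 + 1) expnDn.
have lt_n : n < (n + n).+1 by rewrite ltnS leq_addr.
rewrite (bigD1 (Ordinal lt_n)) //= !exp1n !muln1; exact: leq_addr.
Qed.

(** Minimality of [egz G] yields an extremal [S], and property D gives its support [T]. A
    nonconstant [l] over [T] would embed, up to order, into [S], which has no zero-sum subsequence
    of length [expo G]. *)
Lemma propertyD_rigid (G : finZmodType) : propertyD G ->
  exists T : {set G}, egz G = (expo G).-1 * #|T| + 1 /\
    forall l : seq G, {subset l <= T} -> size l = expo G ->
      (\sum_(x <- l) x = 0)%R -> constant l.
Proof.
move=> hD.
have e_gt0 : 0 < expo G by exact: exponent_gt0.
have [S sz_S S_free] : exists2 S : seq G, size S = (egz G).-1 & ~~ has_zero_sum S.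
  have : ~~ egz_bound G (egz G).-1.
    apply/negP => bnd; have := egz_gt0 G.
    by move: bnd; rewrite /egz; case: ex_minnP => -[//|m] _ min_m /min_m; rewrite ltnn.
  by case/forallPn => S S_free; exists S; rewrite ?size_tuple.
have [T S_T] := hD S sz_S S_free; exists T; split.
  rewrite -[LHS]prednK ?egz_gt0 // -sz_S (perm_size S_T) addn1; congr _.+1.
  by rewrite size_flatten /shape map_nseq sumn_nseq -cardE mulnC.
move=> l l_T sz_l sum_l; apply: contraNT S_free => l_nonconst.
have /count_subseqP[s s_S l_s] x : count_mem x l <= count_mem x S.
  rewrite (seq.permP S_T) count_flatten map_nseq sumn_nseq (count_uniq_mem x (enum_uniq T)).
  rewrite mem_enum; case: (boolP (x \in T)) => [xT | xNT]; last first.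
    by rewrite leqn0 -[_ == 0]negbK -lt0n -has_count has_pred1; apply: contra xNT => /l_T.
  (* A nonconstant [l] of length [expo G] repeats no element more than [expo G - 1] times, its
     multiplicity in [S]. *)
  rewrite mul1n -ltnS prednK // -sz_l ltn_neqAle count_size andbT -all_count.
  by apply: contra l_nonconst; case: (l) => //= y r /andP[/eqP->].
have sz_s : size s == expo G by rewrite -(perm_size l_s) sz_l.
apply/existsP; exists (Tuple sz_s); rewrite s_S /=.
by rewrite -(perm_big _ l_s) sum_l.
Qed.

Theorem theorem3 (q n : nat)
    (hq : exists p k : nat, [/\ prime p, 0 < k & q = p ^ k])
    (hn : 1 <= n)
    (hD : propertyD 'rV['Z_q]_n) :
  egz 'rV['Z_q]_n <= (q - 1) * 4 ^ n + 1.
Proof.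
have [p [k [p_pr k_gt0 q_pk]]] := hq.
have q_gt1 : 1 < q by rewrite q_pk -(exp1n k) ltn_exp2r ?prime_gt1.
have [T [-> T_rigid]] := propertyD_rigid hD.
rewrite expo_rV_Zp // in T_rigid *.
rewrite leq_add2r subn1 leq_mul2l; apply/orP; right.
apply: leq_trans (bin_double_le n).
(* Coordinates are lifted to their natural number representatives, so that zero sums become
   divisibility by [q]. *)
pose pt (x : {x | x \in T}) (c : 'I_n) : nat := val x ord0 c.
have := @card_rigid_family p k n _ pt p_pr k_gt0; rewrite -q_pk card_sig; apply.
move=> l sz_l dvd_l; have : constant [seq val x | x <- l].
  apply: T_rigid; rewrite ?size_map //.
    by move=> _ /mapP[x _ ->]; exact: valP.
  apply/rowP => c; rewrite big_map summxE mxE.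
  under eq_bigr => x _ do rewrite -[val x _ c]natr_Zp.
  by apply/eqP; rewrite -natr_sum natr_Zp_eq0 //; exact: dvd_l.
case: (l) => //= x r; rewrite all_map; apply: sub_all => y /=.
by rewrite (inj_eq val_inj).
Qed.
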